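(* The following five identities all hold, where $\ln$ denotes the natural logarithm: (a) $$\sum_{n=1}^{\infty} \frac{1}{n(2n-1)(4n-1)(4n-3)} = 2\ln 2-\frac{\pi}{3},$$ (b) $$\sum_{n=1}^{\infty} \frac{1}{n(4n+1)(4n-1)(4n-3)} = \frac{\pi}{12}-\ln 2+\frac{1}{2},$$ (c) $$\sum_{n=1}^{\infty} \frac{1}{(2n-1)(4n+1)(4n-1)(4n-3)} = \frac{1}{6}\left(\ln 2-\frac{\pi}{4}+\frac{1}{2}\right),$$ (d) $$\sum_{n=1}^{\infty} \frac{1}{n(2n-1)(4n+1)(4n-3)} = \frac{2}{3}\left(1-\ln 2\right),$$ (e) $$\sum_{n=1}^{\infty} \frac{1}{n(2n-1)(4n+1)(4n-1)(4n-3)} = \frac{1}{3}\left(4\ln 2-\frac{\pi}{2}-1\right).$$ *)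

(* Defs.v *)
From Stdlib Require Import Reals.
From Coquelicot Require Import Coquelicot.
Open Scope R_scope.

(** [sum_from_1 a l]: the series a 1 + a 2 + a 3 + ... converges to [l].
    Coquelicot's [is_series] starts at index 0, hence the shift. *)
Definition sum_from_1 (a : R -> R) (l : R) : Prop :=
  is_series (fun k : nat => a (INR (S k))) l.

(* Main.v *)
Require Import Defs.
From Stdlib Require Import Reals Lra Lia.
From Coquelicot Require Import Coquelicot.
Open Scope R_scope.

(** Each summand splits into partial fractions over the denominators n, 2n-1,
    4n-1, 4n-3 and 4n+1, and is a linear combination of the general terms of four
    convergent series: Leibniz's series grouped in pairs (sum PI/4), the
    alternating harmonic series grouped in pairs (sum ln 2), a rearrangement of
    it with terms 1/(4n-3) + 1/(4n-1) - 1/(2n-1) (sum (ln 2)/2), and the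
    telescoping series 1/(4n-3) - 1/(4n+1) (sum 1).  The two logarithmic sums
    follow from the convergence of H_n - ln n. *)

Lemma sum_n_S (a : nat -> R) (n : nat) : sum_n a (S n) = sum_n a n + a (S n) :> R.
Proof. exact (sum_Sn _ _). Qed.

(** Off by one: [harmonic n] is the harmonic number H_(n+1). *)
Definition harmonic (n : nat) : R := sum_n (fun k => / INR (S k)) n.

Lemma harmonic_S (n : nat) : harmonic (S n) = harmonic n + / INR (S (S n)).
Proof. exact (sum_n_S _ _). Qed.

Lemma ln_le_minus_1 (x : R) : 0 < x -> ln x <= x - 1.
Proof.
  intros Hx.
  pose proof (exp_ineq1_le (ln x)) as H.
  rewrite exp_ln in H by exact Hx.
  lra.
Qed.

(** Both bounds are the tangent inequality for ln, taken at the ratio x / (x + 1) and at its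
    reciprocal. *)
Lemma ln_succ_bounds (x : R) :
  0 < x -> / (x + 1) <= ln (x + 1) - ln x <= / x.
Proof.
  intros Hx.
  pose proof (ln_le_minus_1 (x / (x + 1)) ltac:(apply Rdiv_lt_0_compat; lra)) as H1.
  pose proof (ln_le_minus_1 ((x + 1) / x) ltac:(apply Rdiv_lt_0_compat; lra)) as H2.
  rewrite ln_div in H1 by lra.
  rewrite ln_div in H2 by lra.
  replace (x / (x + 1) - 1) with (- / (x + 1)) in H1 by (field; lra).
  replace ((x + 1) / x - 1) with (/ x) in H2 by (field; lra).
  lra.
Qed.

Lemma ln_le_harmonic (n : nat) : ln (INR (S (S n))) <= harmonic n.
Proof.
  induction n as [|n IH].
  - unfold harmonic. rewrite sum_O.
    pose proof (ln_succ_bounds 1 ltac:(lra)) as H.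
    rewrite ln_1 in H. simpl. lra.
  - rewrite harmonic_S, (S_INR (S (S n))).
    pose proof (ln_succ_bounds (INR (S (S n))) (lt_0_INR _ (Nat.lt_0_succ _))).
    lra.
Qed.

(** A decreasing sequence bounded below by 0. The limit is Euler's constant, but its value never
    matters: later combinations use it with coefficients that add up to 0. *)
Lemma harmonic_minus_ln_cv :
  exists g : R, is_lim_seq (fun n => harmonic n - ln (INR (S n))) g.
Proof.
  apply (ex_finite_lim_seq_decr _ 0).
  - intros n. rewrite harmonic_S, (S_INR (S n)).
    pose proof (ln_succ_bounds (INR (S n)) (lt_0_INR _ (Nat.lt_0_succ _))).
    lra.
  - intros n. pose proof (ln_le_harmonic n) as H.
    rewrite (S_INR (S n)) in H.
    pose proof (ln_succ_bounds (INR (S n)) (lt_0_INR _ (Nat.lt_0_succ _))) as H1.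
    pose proof (Rinv_0_lt_compat (INR (S n) + 1)
      ltac:(pose proof (pos_INR (S n)); lra)).
    lra.
Qed.

Lemma is_lim_seq_affine_subseq (u : nat -> R) (l : R) (a b : nat) :
  (0 < a)%nat -> is_lim_seq u l -> is_lim_seq (fun n => u (a * n + b)%nat) l.
Proof.
  intros Ha Hu.
  apply (is_lim_seq_subseq u l (fun n => (a * n + b)%nat)); [|exact Hu].
  apply eventually_subseq. intros n. nia.
Qed.

Lemma is_series_of_sum_n (a s : nat -> R) (l : R) :
  (forall n, sum_n a n = s n :> R) -> is_lim_seq s l -> is_series a l.
Proof.
  intros Has Hs.
  apply (is_lim_seq_ext s (sum_n a) l); [|exact Hs].
  intros n. symmetry. apply Has.
Qed.

Lemma INR_S_ge_1 (k : nat) : 1 <= INR (S k).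
Proof. rewrite S_INR. pose proof (pos_INR k). lra. Qed.

Lemma alternating_harmonic_pairs :
  sum_from_1 (fun n => 1 / (2 * n - 1) - 1 / (2 * n)) (ln 2).
Proof.
  destruct harmonic_minus_ln_cv as [g Hg].
  set (c := fun n => harmonic n - ln (INR (S n))) in Hg.
  (* With N = n + 1, the partial sum is H_(2N) - H_N, and ln (2N) - ln N = ln 2. The index
     [1 * n + 0] fits [is_lim_seq_affine_subseq]. *)
  apply (is_series_of_sum_n _ (fun n => c (2 * n + 1)%nat - c (1 * n + 0)%nat + ln 2)).
  - intros n. transitivity (harmonic (2 * n + 1) - harmonic n).
    + induction n as [|n IH].
      * unfold harmonic. simpl (2 * 0 + 1)%nat.
        rewrite sum_n_S, !sum_O. simpl. field.
      * rewrite sum_n_S, IH.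
        replace (2 * S n + 1)%nat with (S (S (2 * n + 1))) by lia.
        rewrite !harmonic_S.
        rewrite !S_INR, plus_INR, mult_INR. simpl INR.
        pose proof (pos_INR n).
        field; lra.
    + unfold c.
      replace (1 * n + 0)%nat with n by lia.
      replace (S (2 * n + 1)) with (2 * S n)%nat by lia.
      rewrite mult_INR, ln_mult by (apply lt_0_INR; lia).
      simpl (INR 2). replace (1 + 1) with 2 by ring. ring.
  - replace (Finite (ln 2)) with (Finite (g - g + ln 2)) by (f_equal; ring).
    apply is_lim_seq_plus'; [|apply is_lim_seq_const].
    apply is_lim_seq_minus'; apply is_lim_seq_affine_subseq; auto with arith.
Qed.

Lemma rearranged_alternating_harmonic :
  sum_from_1 (fun n => 1 / (4 * n - 3) + 1 / (4 * n - 1) - 1 / (2 * n - 1))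
    (ln 2 / 2).
Proof.
  destruct harmonic_minus_ln_cv as [g Hg].
  set (c := fun n => harmonic n - ln (INR (S n))) in Hg.
  (* With N = n + 1, the odd reciprocals below 4N add up to H_(4N) - H_(2N) / 2 and those below 2N
     to H_(2N) - H_N / 2. Subtracting gives the coefficients 1, -3/2, 1/2; the logarithms leave 2 ln
     2 - (3/2) ln 2. *)
  apply (is_series_of_sum_n _ (fun n => c (4 * n + 3)%nat - 3 / 2 * c (2 * n + 1)%nat
    + 1 / 2 * c (1 * n + 0)%nat + ln 2 / 2)).
  - intros n.
    transitivity (harmonic (4 * n + 3) - 3 / 2 * harmonic (2 * n + 1) + 1 / 2 * harmonic n).
    + induction n as [|n IH].
      * unfold harmonic. simpl (2 * 0 + 1)%nat. simpl (4 * 0 + 3)%nat.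
        rewrite !sum_n_S, !sum_O. simpl. field.
      * rewrite sum_n_S, IH.
        replace (2 * S n + 1)%nat with (S (S (2 * n + 1))) by lia.
        replace (4 * S n + 3)%nat with (S (S (S (S (4 * n + 3))))) by lia.
        rewrite !harmonic_S.
        rewrite !S_INR, !plus_INR, !mult_INR. simpl INR.
        pose proof (pos_INR n).
        field; lra.
    + unfold c.
      replace (1 * n + 0)%nat with n by lia.
      replace (S (4 * n + 3)) with (2 * (2 * S n))%nat by lia.
      replace (S (2 * n + 1)) with (2 * S n)%nat by lia.
      rewrite (mult_INR 2 (2 * S n)), ln_mult by (apply lt_0_INR; lia).
      rewrite (mult_INR 2 (S n)), ln_mult by (apply lt_0_INR; lia).
      simpl (INR 2). replace (1 + 1) with 2 by ring. field.
  - replace (Finite (ln 2 / 2)) with (Finite (g - 3 / 2 * g + 1 / 2 * g + ln 2 / 2))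
      by (f_equal; field).
    apply is_lim_seq_plus'; [|apply is_lim_seq_const].
    apply is_lim_seq_plus'; [apply is_lim_seq_minus'|].
    + apply is_lim_seq_affine_subseq; auto with arith.
    + apply (is_lim_seq_scal_l _ (3 / 2) g).
      apply is_lim_seq_affine_subseq; auto with arith.
    + apply (is_lim_seq_scal_l _ (1 / 2) g).
      apply is_lim_seq_affine_subseq; auto with arith.
Qed.

Lemma Leibniz_lim : is_lim_seq (sum_f_R0 (tg_alt PI_tg)) (PI / 4).
Proof.
  apply is_lim_seq_Reals.
  (* [Alt_PI] is by definition 4 times the limit of this very series. *)
  rewrite <- Alt_PI_eq. unfold Alt_PI.
  destruct exist_PI as [l Hl].
  replace (4 * l / 4) with l by field.
  exact Hl.
Qed.

Lemma Leibniz_pairs :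
  sum_from_1 (fun n => 1 / (4 * n - 3) - 1 / (4 * n - 1)) (PI / 4).
Proof.
  (* The n + 1 pairs use up the Leibniz terms of index 0 to 2n + 1. *)
  apply (is_series_of_sum_n _ (fun n => sum_f_R0 (tg_alt PI_tg) (2 * n + 1))).
  - induction n as [|n IH].
    + rewrite sum_O. unfold tg_alt, PI_tg. simpl. field.
    + rewrite sum_n_S, IH.
      replace (2 * S n + 1)%nat with (S (S (2 * n + 1))) by lia.
      rewrite !tech5, Rplus_assoc. f_equal.
      unfold tg_alt, PI_tg.
      replace (S (S (2 * n + 1))) with (S (2 * S n)) by lia.
      replace (S (2 * n + 1)) with (2 * S n)%nat by lia.
      rewrite pow_1_odd, pow_1_even.
      rewrite !plus_INR, !mult_INR, !S_INR, !mult_INR, !S_INR. simpl INR.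
      pose proof (pos_INR n).
      field; lra.
  - apply is_lim_seq_affine_subseq; [lia|exact Leibniz_lim].
Qed.

Lemma telescoping_quarters :
  sum_from_1 (fun n => 1 / (4 * n - 3) - 1 / (4 * n + 1)) 1.
Proof.
  (* The last summand is taken at n + 1, and 4(n + 1) + 1 = 4n + 5. *)
  apply (is_series_of_sum_n _ (fun n => 1 - / INR (4 * n + 5))).
  - induction n as [|n IH].
    + rewrite sum_O. simpl. field.
    + rewrite sum_n_S, IH.
      rewrite !plus_INR, !mult_INR, !S_INR. simpl INR.
      pose proof (pos_INR n).
      field; lra.
  - replace (Finite 1) with (Finite (1 - 0)) by (f_equal; ring).
    apply is_lim_seq_minus'; [apply is_lim_seq_const|].
    apply (is_lim_seq_affine_subseq (fun n => / INR n)); [lia|].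
    apply (is_lim_seq_inv INR p_infty); [apply is_lim_seq_INR|discriminate].
Qed.

(** Leaves each identity to two [field] computations. Taking n real and at least 1 keeps all the
    denominators positive. *)
Lemma sum_from_1_combination (a : R -> R) (s g l m t : R) :
  (forall n, 1 <= n ->
     a n = g * (1 / (4 * n - 3) - 1 / (4 * n - 1))
         + l * (1 / (2 * n - 1) - 1 / (2 * n))
         + m * (1 / (4 * n - 3) + 1 / (4 * n - 1) - 1 / (2 * n - 1))
         + t * (1 / (4 * n - 3) - 1 / (4 * n + 1))) ->
  s = g * (PI / 4) + l * ln 2 + m * (ln 2 / 2) + t * 1 ->
  sum_from_1 a s.
Proof.
  intros Ha ->. unfold sum_from_1.
  eapply is_series_ext.
  { intros k. symmetry. apply (Ha _ (INR_S_ge_1 k)). }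
  apply (is_series_plus (V := R_NormedModule));
    [apply (is_series_plus (V := R_NormedModule));
      [apply (is_series_plus (V := R_NormedModule))|]|];
    apply (is_series_scal (V := R_NormedModule)).
  - exact Leibniz_pairs.
  - exact alternating_harmonic_pairs.
  - exact rearranged_alternating_harmonic.
  - exact telescoping_quarters.
Qed.

Theorem theorem2 :
  sum_from_1 (fun n : R => 1 / (n * (2 * n - 1) * (4 * n - 1) * (4 * n - 3)))
    (2 * ln 2 - PI / 3)
  /\
  sum_from_1 (fun n : R => 1 / (n * (4 * n + 1) * (4 * n - 1) * (4 * n - 3)))
    (PI / 12 - ln 2 + 1 / 2)
  /\
  sum_from_1 (fun n : R => 1 / ((2 * n - 1) * (4 * n + 1) * (4 * n - 1) * (4 * n - 3)))
    (1 / 6 * (ln 2 - PI / 4 + 1 / 2))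
  /\
  sum_from_1 (fun n : R => 1 / (n * (2 * n - 1) * (4 * n + 1) * (4 * n - 3)))
    (2 / 3 * (1 - ln 2))
  /\
  sum_from_1 (fun n : R => 1 / (n * (2 * n - 1) * (4 * n + 1) * (4 * n - 1) * (4 * n - 3)))
    (1 / 3 * (4 * ln 2 - PI / 2 - 1)).
Proof.
  split; [|split; [|split; [|split]]].
  - apply (sum_from_1_combination _ _ (- 4 / 3) (2 / 3) (8 / 3) 0);
      [intros n Hn; field; lra | field].
  - apply (sum_from_1_combination _ _ (1 / 3) (- 2 / 3) (- 2 / 3) (1 / 2));
      [intros n Hn; field; lra | field].
  - apply (sum_from_1_combination _ _ (- 1 / 6) 0 (1 / 3) (1 / 12));
      [intros n Hn; field; lra | field].
  - apply (sum_from_1_combination _ _ 0 (- 2 / 3) 0 (2 / 3));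
      [intros n Hn; field; lra | field].
  - apply (sum_from_1_combination _ _ (- 2 / 3) (2 / 3) (4 / 3) (- 1 / 3));
      [intros n Hn; field; lra | field].
Qed.
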